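(* There is a constant $c$ such that for every $n\ge1$, there is a $(\mathrm{Sym}_{n+1}\times\mathrm{Sym}_n)$-symmetric $\vec y$-linear IPS refutation of $\mathrm{PHP}(n+1,n)$ over $\mathbb{Q}$ of size at most $c\cdot 3^n\cdot n$.
   Context: Pigeonhole principle: $\mathrm{PHP}(n+1,n)\subseteq\mathbb{Q}[X]$ has variables $X=\{x_{ij}: i\in[n+1], j\in[n]\}$ and polynomials $x^2-x$ for $x\in X$, $\sum_{j\in[n]}x_{ij}-1$ for every $i\in[n+1]$, and $x_{ij}x_{i'j}$ for every $j\in[n]$ and $i\neq i'\in[n+1]$; it is unsatisfiable. $\mathrm{Sym}_{n+1}\times\mathrm{Sym}_n$ acts on $X$ by $(\pi,\sigma)(x_{ij})=x_{\pi(i)\sigma(j)}$, and $\mathrm{PHP}(n+1,n)$ is invariant. An algebraic circuit over variables $Z$ and field $\mathbb{F}$ is a connected DAG with input gates labelled by elements of $Z\cup\mathbb{F}$ and internal gates labelled $+$ or $\times$ (arbitrary fan-in), single output, computing a polynomial. It is $\Gamma$-symmetric (for $\Gamma$ acting on $Z$, trivially on $\mathbb{F}$) if each $\pi\in\Gamma$ extends to a DAG automorphism preserving internal labels and mapping each input gate labelled $z$ to one labelled $\pi(z)$. IPS: for $\mathcal{F}=\{f_1,\dots,f_m\}$ and fresh $Y=\{y_1,\dots,y_m\}$, an IPS certificate is $C(\vec x,\vec y)$ with $C(\vec x,\vec 0)=0$, $C(\vec x,f_1,\dots,f_m)=1$; an IPS refutation is a circuit over $X\uplus Y$ computing one; its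 size is $\max(\text{number of gates},|X|+|Y|)$; it is $\vec y$-linear if the certificate is $\sum_iy_ig_i(\vec x)$. For $\Gamma$-invariant $\mathcal{F}$, $\Gamma$ acts on $Y$ by $\pi(y_i)=y_j$ where $\pi(f_i)=f_j$; a $\Gamma$-symmetric IPS refutation is one that is a $\Gamma$-symmetric circuit w.r.t. this action on $X\uplus Y$. *)

(* Defs.v *)
From HB Require Import structures.
From mathcomp Require Import all_boot all_algebra all_fingroup all_solvable.
From mathcomp Require Import finmap.
From mathcomp Require Import mpoly.

Set Implicit Arguments.
Unset Strict Implicit.
Unset Printing Implicit Defensive.

Import GRing.Theory.
Local Open Scope ring_scope.
Local Open Scope fset_scope.

(* mpoly only has variables indexed by ordinals; a finite set Z of variables is
   numbered by enum_rank. *)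
Notation mpolyOver K Z := {mpoly K[#|Z|]}.

Section Polynomials.
Variable K : fieldType.

Definition mvar (Z : finType) (z : Z) : mpolyOver K Z := 'X_(enum_rank z).

Definition msubst (Z : finType) (k : nat) (h : Z -> {mpoly K[k]})
    (p : mpolyOver K Z) : {mpoly K[k]} :=
  p \mPo [tuple h (enum_val i) | i < #|Z|].

Lemma msubst_var (Z : finType) k (h : Z -> {mpoly K[k]}) z :
  msubst h (mvar z) = h z.
Proof.
by rewrite /msubst /mvar comp_mpolyXU -tnth_nth tnth_mktuple enum_rankK.
Qed.

End Polynomials.

Section Circuits.
Variables (K : fieldType) (Z : finType).

Inductive gate_label := LVar of Z | LConst of K | LAdd | LMul.

Definition is_input (l : gate_label) : bool :=
  match l with LVar _ | LConst _ => true | LAdd | LMul => false end.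

(* wire g h : the gate g is an input of the gate h. *)
Record circuit := Circuit {
  gate : finType;
  wire : rel gate;
  label : gate -> gate_label;
  output : gate;
  wire_acyclic : forall g h, wire g h -> ~~ connect wire h g;
  wire_connected : forall g h, connect (fun u v => wire u v || wire v u) g h;
  label_input : forall g, is_input (label g) = [forall h, ~~ wire h g];
  single_output : forall g, [forall h, ~~ wire g h] = (g == output)
}.

(* As the circuit is acyclic, the equations on v have exactly one solution. *)
Definition computes (C : circuit) (p : mpolyOver K Z) : Prop :=
  exists v : gate C -> mpolyOver K Z,
    (forall g, v g = match label g with
                     | LVar z => mvar K z
                     | LConst a => a%:MP
                     | LAdd => \sum_(h | wire h g) v h
                     | LMul => \prod_(h | wire h g) v h
                     end)
    /\ v (output C) = p.

Definition act_label (a : Z -> Z) (l : gate_label) : gate_label :=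
  if l is LVar z then LVar (a z) else l.

Definition extends_to_automorphism (C : circuit) (a : Z -> Z) : Prop :=
  exists s : {perm gate C},
    (forall g h, wire (s g) (s h) = wire g h)
    /\ (forall g, label (s g) = act_label a (label g)).

Definition symmetric_circuit (gT : finGroupType) (act : gT -> Z -> Z)
    (C : circuit) : Prop :=
  forall pi : gT, extends_to_automorphism C (act pi).

End Circuits.

Section IPS.
Variables (K : fieldType) (X : finType) (F : {fset mpolyOver K X}).

(* The variables X + Y: there is one fresh variable y_f = inr f for each
   polynomial f in the set F. *)
Definition ips_var : finType := (X + F)%type.

Definition ips_certificate (c : mpolyOver K ips_var) : Prop :=
  msubst (fun z : ips_var => if z is inl x then mvar K x else 0) c = 0
  /\ msubst (fun z : ips_var =>
               match z with inl x => mvar K x | inr f => val f end) c = 1.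

Definition y_linear (c : mpolyOver K ips_var) : Prop :=
  exists g : F -> mpolyOver K X,
    c = \sum_(f : F) mvar K (inr f : ips_var)
                     * msubst (fun x => mvar K (inl x : ips_var)) (g f).

Definition y_linear_ips_refutation (C : circuit K ips_var) : Prop :=
  exists c : mpolyOver K ips_var,
    [/\ computes C c, ips_certificate c & y_linear c].

Definition ips_size (C : circuit K ips_var) : nat :=
  maxn #|gate C| (#|X| + #|` F|).

Variables (gT : finGroupType) (to : {action gT &-> X}).

Definition act_poly (pi : gT) (p : mpolyOver K X) : mpolyOver K X :=
  msubst (fun x => mvar K (to x pi)) p.

Definition invariant_system : Prop :=
  forall pi p, p \in F -> act_poly pi p \in F.

(* pi(y_f) = y_{pi(f)}; the default value of insubd is never used when F is an
   invariant system. *)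
Definition ips_act (pi : gT) (z : ips_var) : ips_var :=
  match z with
  | inl x => inl (to x pi)
  | inr f => inr (insubd f (act_poly pi (val f)))
  end.

Definition symmetric_ips (C : circuit K ips_var) : Prop :=
  symmetric_circuit ips_act C.

End IPS.

Section PHP.
Variable n : nat.

Definition php_var : finType := ('I_n.+1 * 'I_n)%type.

Definition php_x (i : 'I_n.+1) (j : 'I_n) : mpolyOver rat php_var :=
  mvar rat ((i, j) : php_var).

Definition PHP : {fset mpolyOver rat php_var} :=
  [fset mvar rat x ^+ 2 - mvar rat x | x : php_var]
  `|` [fset \sum_(j < n) php_x i j - 1 | i : 'I_n.+1]
  `|` [fset php_x t.1.1 t.2 * php_x t.1.2 t.2
         | t : 'I_n.+1 * 'I_n.+1 * 'I_n & t.1.1 != t.1.2].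

Definition php_group : finGroupType := ('S_n.+1 * 'S_n)%type.

Definition php_act_fun (x : php_var) (ps : php_group) : php_var :=
  (ps.1 x.1, ps.2 x.2).

Lemma php_act1 x : php_act_fun x 1%g = x.
Proof. by case: x => i j; rewrite /php_act_fun /= !perm1. Qed.

Lemma php_actM x : act_morph php_act_fun x.
Proof. by move=> [p1 s1] [p2 s2]; rewrite /php_act_fun /= !permM. Qed.

Definition php_act : {action php_group &-> php_var} :=
  TotalAction php_act1 php_actM.

Lemma PHP_invariant : invariant_system PHP php_act.
Proof.
move=> [p s] q.
have act_var x : act_poly php_act (p, s) (mvar rat x)
    = mvar rat (p x.1, s x.2) by exact: msubst_var.
rewrite !in_fsetU -!orbA => /or3P[] /imfsetP[/= x xP ->].
- apply/or3P; apply: Or31; apply/imfsetP; exists (php_act x (p, s)) => //=.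
  rewrite /act_poly /msubst rmorphB rmorphXn /=.
  by congr (_ ^+ 2 - _); exact: act_var.
- apply/or3P; apply: Or32; apply/imfsetP; exists (p x) => //=.
  rewrite /act_poly /msubst rmorphB rmorph1 rmorph_sum /=.
  rewrite [in RHS](reindex_inj (@perm_inj _ s)).
  by congr (_ - _); apply: eq_bigr => j _; exact: act_var.
- apply/or3P; apply: Or33; apply/imfsetP.
  exists (p x.1.1, p x.1.2, s x.2) => /=.
    by move: xP; rewrite !inE /= (inj_eq perm_inj).
  by rewrite /act_poly /msubst rmorphM /=; congr (_ * _); exact: act_var.
Qed.

End PHP.

(* Main.v *)
Require Import Defs.
From HB Require Import structures.
From mathcomp Require Import all_boot all_algebra all_fingroup all_solvable.
From mathcomp Require Import finmap.
From mathcomp Require Import mpoly.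
From mathcomp Require Import ring zify.

(* Put t_j = \sum_i x_ij and T = \sum_j t_j. Summing the pigeon axioms gives
   T - (n+1), and the remaining axioms for the hole j sum to t_j^2 - t_j, so PHP
   reduces to the knapsack instance T = n+1 with Boolean t_j. Modulo the
   t_j^2 - t_j, the inverse of T - (n+1) is the multilinear polynomial
   \sum_A c_|A| \prod_(j in A) t_j over the sets A of holes, for constants c_k
   determined by a recurrence. Expanding over A and over the axioms gives a
   symmetric sum of about 2^n n^3 products of the t_j, a constant and one y
   variable, and 2^n n^2 = O(3^n). *)

Set Implicit Arguments.
Unset Strict Implicit.
Unset Printing Implicit Defensive.

Import GRing.Theory Num.Theory.
Local Open Scope ring_scope.

(** * Graphs whose edges raise a level *)

Section LeveledGraphs.
Variables (T : finType) (e : rel T) (level : T -> nat).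
Hypothesis e_level : forall x y, e x y -> (level x < level y)%N.

Lemma level_connect x y : connect e x y -> (level x <= level y)%N.
Proof.
case/connectP=> p; elim: p x => [|z p IHp] x /=; first by move=> _ ->.
by case/andP=> /e_level/ltnW le_xz /IHp{}IHp /IHp; apply: leq_trans.
Qed.

Lemma level_acyclic x y : e x y -> ~~ connect e y x.
Proof.
by move=> /e_level lt_xy; apply/negP => /level_connect; rewrite leqNgt lt_xy.
Qed.

(** Every vertex other than the sink [r] has an outgoing edge, which raises the bounded level, so
    following edges must end at [r]. *)
Lemma level_connected r :
    (forall x, [forall y, ~~ e x y] = (x == r)) ->
  forall x y, connect (fun u v => e u v || e v u) x y.
Proof.
move=> sink_r; set e' := fun u v => _.
have e'C : connect_sym e' by apply: sym_connect_sym => x y; rewrite /e' orbC.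
suff to_r x : connect e' x r.
  by move=> x y; apply: connect_trans (to_r x) _; rewrite e'C.
have [k le_k] := ubnP (\max_y level y - level x)%N.
elim: k => // k IHk in x le_k *.
have [->|] := eqVneq x r; first exact: connect0.
rewrite -sink_r negb_forall => /existsP[y]; rewrite negbK => exy.
apply: (connect_trans (y := y)); first by apply: connect1; rewrite /e' exy.
have lt_xy := e_level exy; have := leq_bigmax (F := level) y.
by move=> le_y; apply: IHk; lia.
Qed.

End LeveledGraphs.

(** * The knapsack identity *)

Section Knapsack.
Variables (R : comNzRingType) (n : nat).

(** Adding [j] to [A] is a bijection from pairs with [j] outside [A] to pairs with [j] inside; this
    collects all contributions to one monomial. *)
Lemma sum_setD1 (F : {set 'I_n} -> 'I_n -> R) :
  \sum_(A : {set 'I_n}) \sum_(j in ~: A) F A j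
    = \sum_(A : {set 'I_n}) \sum_(j in A) F (A :\ j)%SET j.
Proof.
rewrite (exchange_big_dep predT) //= [RHS](exchange_big_dep predT) //=.
apply: eq_bigr => j _.
rewrite (reindex_onto (fun A => A :\ j)%SET (fun A => j |: A)%SET) /=.
  apply: eq_bigl => A; rewrite !inE eqxx /=.
  have [Aj|nAj] := boolP (j \in A); first by rewrite setD1K ?eqxx.
  by apply: contraNF nAj => /eqP <-; rewrite setU11.
by move=> A; rewrite inE => nAj; rewrite setU1K.
Qed.

(* The multilinear polynomial \sum_A c #|A| * \prod_(j in A) t j inverts
   \sum_j t j - n.+1 modulo the t j ^+ 2 - t j; the recurrence on c cancels
   the coefficients of all nonempty A. *)
Lemma knapsack_identity (t : 'I_n -> R) (c : nat -> R) :
    c 0 * n.+1%:R = - 1 ->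
    (forall k, (k < n)%N -> c k.+1 * (n - k)%:R = c k * k.+1%:R) ->
  \sum_(A : {set 'I_n})
     (c #|A| * \prod_(j in A) t j * (\sum_j t j - n.+1%:R)
      + \sum_(j in ~: A) (- c #|A|.+1) * \prod_(i in A) t i * (t j ^+ 2 - t j))
  = 1.
Proof.
move=> c0 cS.
have tD1 (A : {set 'I_n}) j : j \in A ->
    \prod_(i in A) t i = t j * \prod_(i in (A :\ j)%SET) t i.
  by move=> Aj; rewrite (big_setD1 j).
rewrite big_split /= (sum_setD1 (fun A j => - c #|A|.+1 * _ * _)).
(* The sum of the [t j] is split by membership in [A]: the part outside [A] produces larger
   monomials and is reindexed below. *)
have -> : \sum_(A : {set 'I_n}) c #|A| * \prod_(j in A) t j
              * (\sum_j t j - n.+1%:R)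
    = \sum_(A : {set 'I_n}) (\sum_(j in A) c #|A| * \prod_(i in A) t i * t j
           - c #|A| * n.+1%:R * \prod_(j in A) t j)
      + \sum_(A : {set 'I_n}) \sum_(j in ~: A)
           c #|A| * \prod_(i in A) t i * t j.
  rewrite -big_split; apply: eq_bigr => A _ /=.
  rewrite -!big_distrr /= [\sum_j t j](bigID (mem A)) /=.
  have -> : \sum_(j in ~: A) t j = \sum_(j | j \notin A) t j.
    by apply: eq_bigl => j; rewrite inE.
  by ring.
rewrite (sum_setD1 (fun A j => c #|A| * _ * _)) -!big_split /=.
(* The empty set contributes - c_0 (n+1) = 1; every other set must contribute 0. *)
rewrite (bigD1 set0) //= !big_set0 cards0 mulr1 c0 sub0r opprK !addr0.
rewrite big1 ?addr0 // => A A0.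
have cA : (0 < #|A| <= n)%N.
  by rewrite card_gt0 A0 -[X in (_ <= X)%N]card_ord max_card.
have cD1 j : j \in A -> #|A| = #|(A :\ j)%SET|.+1.
  by move=> Aj; rewrite (cardsD1 j) Aj.
rewrite addrAC -addrA -!big_split /= addrAC -big_split /=.
(* The terms with t_j^2 cancel, so all [j] in [A] contribute equally. *)
rewrite (eq_bigr (fun=> (c #|A|.-1 + c #|A|) * \prod_(i in A) t i)).
  have [A_gt0 leAn] := andP cA.
  (* This is the recurrence at |A| - 1; the subtraction does not truncate since 0 < |A| <= n. *)
  have e : c #|A| * (n%:R - #|A|%:R + 1) = c #|A|.-1 * #|A|%:R.
    have := cS #|A|.-1; rewrite prednK // => <- //.
    by congr (_ * _); rewrite -natrB // natr1; congr (_%:R); lia.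
  rewrite sumr_const -mulr_natr [LHS](_ : _ = (c #|A|.-1 * #|A|%:R
    - c #|A| * (n%:R - #|A|%:R + 1)) * \prod_(i in A) t i).
    by rewrite e subrr mul0r.
  by rewrite -[n.+1]addn1 natrD; ring.
by move=> j Aj; rewrite (tD1 _ _ Aj) (cD1 j Aj) /=; ring.
Qed.
End Knapsack.

(** * Substitution as a ring morphism *)

Section Substitution.
Variables (K : fieldType) (Z : finType) (k : nat) (h : Z -> {mpoly K[k]}).

HB.instance Definition _ := GRing.RMorphism.copy (msubst h)
  (comp_mpoly [tuple h (enum_val i) | i < #|Z|]).

Lemma msubstC a : msubst h a%:MP = a%:MP.
Proof. exact: comp_mpolyC. Qed.

End Substitution.

(** * Pigeonhole axioms and the group action on them *)

Section PigeonholeCircuit.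
Variable n : nat.

(* inr (i, i', j) stands for x_ij x_i'j when i != i', and for x_ij^2 - x_ij
   when i = i'; summed over i and i' these give t_j^2 - t_j, where
   t_j = \sum_i x_ij. *)
Definition clause : finType := ('I_n.+1 + 'I_n.+1 * 'I_n.+1 * 'I_n)%type.

Definition clause_poly (cl : clause) : {mpoly rat[#|php_var n|]} :=
  match cl with
  | inl i => \sum_(j < n) php_x i j - 1
  | inr (i, i', j) =>
      if i == i' then php_x i j ^+ 2 - php_x i j else php_x i j * php_x i' j
  end.

Lemma clause_polyP cl : clause_poly cl \in PHP n.
Proof.
rewrite !in_fsetU -!orbA; case: cl => [i|[[i i'] j]] /=.
  by apply/or3P; apply: Or32; apply/imfsetP; exists i.
have [_|neq_ii'] := eqVneq i i'; apply/or3P.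
  by apply: Or31; apply/imfsetP; exists (i, j).
by apply: Or33; apply/imfsetP; exists (i, i', j).
Qed.

Lemma PHP_clause f : f \in PHP n -> exists cl, f = clause_poly cl.
Proof.
rewrite !in_fsetU -!orbA => /or3P[] /imfsetP[/= x xP ->].
- by case: x xP => i j _; exists (inr (i, i, j)); rewrite /= eqxx.
- by exists (inl x).
case: x xP => [[i i'] j]; rewrite inE /= => /negPf neq_ii'.
by exists (inr (i, i', j)); rewrite /= neq_ii'.
Qed.

(** Not injective in general: exchanging two distinct pigeons [i] and [i'] gives the same axiom, so
    two clauses may name the same y variable. *)
Definition clause_elt (cl : clause) : PHP n := FSetSub (clause_polyP cl).

Definition act_clause (ps : php_group n) (cl : clause) : clause :=
  match cl with
  | inl i => inl (ps.1 i)
  | inr (i, i', j) => inr (ps.1 i, ps.1 i', ps.2 j)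
  end.

Lemma act_clause_inj ps : injective (act_clause ps).
Proof.
move=> [i|[[i i'] j]] [k|[[k k'] l]] //= [].
  by move/perm_inj->.
by move=> /perm_inj-> /perm_inj-> /perm_inj->.
Qed.

Lemma act_clause_poly ps cl :
  act_poly (php_act n) ps (clause_poly cl) = clause_poly (act_clause ps cl).
Proof.
have actX i j : act_poly (php_act n) ps (php_x i j) = php_x (ps.1 i) (ps.2 j).
  exact: msubst_var.
case: cl => [i|[[i i'] j]] /=.
  rewrite /act_poly rmorphB rmorph1 rmorph_sum /=.
  rewrite [in RHS](reindex_inj (@perm_inj _ ps.2)).
  by congr (_ - _); apply: eq_bigr => j _; exact: actX.
rewrite (inj_eq perm_inj); case: ifP => _; rewrite /act_poly.
  by rewrite rmorphB rmorphXn /= -!actX.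
by rewrite rmorphM /= -!actX.
Qed.

Lemma ips_act_clause ps cl :
  ips_act (php_act n) ps (inr (clause_elt cl))
    = inr (clause_elt (act_clause ps cl)).
Proof.
congr inr; apply: val_inj.
by rewrite /= val_insubd act_clause_poly clause_polyP.
Qed.

(* For k <= n this is - 1 / (n.+1 * 'C(n, k)); beyond n it is the junk value 0,
   which only meets the zero coefficients of term_coef. *)
Fixpoint inv_coef (k : nat) : rat :=
  if k is k'.+1 then inv_coef k' * k'.+1%:R / (n - k')%:R else - n.+1%:R^-1.

(** * Terms of the certificate and their sum *)

Definition term : finType := ({set 'I_n} * clause)%type.

(* The unwanted terms, with j \in A, get the coefficient 0 instead of being
   excluded by a subtype. *)
Definition term_coef (tm : term) : rat :=
  match tm.2 with
  | inl _ => inv_coef #|tm.1|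
  | inr (_, j) => if j \in tm.1 then 0 else - inv_coef #|tm.1|.+1
  end.

Definition act_term (ps : php_group n) (tm : term) : term :=
  (ps.2 @: tm.1, act_clause ps tm.2)%SET.

Lemma act_term_inj ps : injective (act_term ps).
Proof.
by move=> [A cl] [B cl'] [/(imset_inj perm_inj)-> /act_clause_inj->].
Qed.

(** The coefficient depends only on |A|, the kind of clause and whether [j] lies in [A], all of
    which the action preserves. *)
Lemma act_term_coef ps tm : term_coef (act_term ps tm) = term_coef tm.
Proof.
case: tm => A [i|[[i i'] j]]; rewrite /term_coef /= card_imset //;
  try exact: perm_inj.
by rewrite mem_imset //; exact: perm_inj.
Qed.

(** For each [A], the pigeon clauses sum to T - (n+1) and the clauses of a hole [j] to t_j^2 - t_j,
    which leaves the knapsack identity. *)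
Lemma certificate_identity :
  \sum_(tm : term) (term_coef tm)%:MP
     * (\prod_(j in tm.1) \sum_i php_x i j) * clause_poly tm.2 = 1.
Proof.
pose t (j : 'I_n) := \sum_(i < n.+1) php_x i j.
apply: etrans (@knapsack_identity _ _ t (fun k => (inv_coef k)%:MP) _ _);
  first last.
- move=> k ltkn; rewrite -!mpolyC_nat -!mpolyCM /= divfK //.
  by rewrite pnatr_eq0 subn_eq0 -ltnNge.
- by rewrite -mpolyC_nat -mpolyCM /= mulNr mulVf ?pnatr_eq0 // mpolyCN mpolyC1.
transitivity (\sum_(A : {set 'I_n}) \sum_(cl : clause)
    (term_coef (A, cl))%:MP * (\prod_(j in A) t j) * clause_poly cl).
  by rewrite [RHS]pair_bigA; apply: eq_bigr => -[].
apply: eq_bigr => A _; rewrite big_sumType {1}/term_coef /=; congr (_ + _).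
  rewrite -big_distrr /=; congr (_ * _).
  rewrite big_split /= sumrN sumr_const card_ord exchange_big /=.
  by [].
transitivity (\sum_(p : 'I_n.+1 * 'I_n.+1) \sum_(j < n)
    (term_coef (A, inr (p, j)))%:MP * (\prod_(k in A) t k)
      * clause_poly (inr (p, j))).
  by rewrite [RHS]pair_bigA; apply: eq_bigr => -[].
rewrite exchange_big /= (bigID (mem A)) /= big1 ?add0r; last first.
  move=> j Aj; rewrite big1 // => p _.
  by rewrite /term_coef /= Aj mpolyC0 !mul0r.
rewrite [RHS](eq_bigl (fun j => j \notin A)) => [|j]; last by rewrite in_setC.
apply: eq_bigr => j nAj.
rewrite /term_coef /= (negPf nAj) -big_distrr /= mpolyCN; congr (_ * _).
rewrite expr2 {1 2}/t big_distrlr /= /t -sumrB.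
transitivity (\sum_i \sum_i' clause_poly (inr (i, i', j))).
  by rewrite [RHS]pair_bigA; apply: eq_bigr => -[].
(* The diagonal pair i' = i of t_j^2 absorbs - x_ij and becomes a Boolean axiom. *)
apply: eq_bigr => i _; rewrite (bigD1 i) //= eqxx [in RHS](bigD1 i) //=.
rewrite expr2 addrAC; congr (_ + _ - _); apply: eq_bigr => i'.
by rewrite eq_sym => /negPf->.
Qed.

(** * The circuit and its symmetry *)

(** Each term has its own constant gate, so that constants are permuted along with the terms. *)
Definition php_gate : finType :=
  (php_var n + (clause + (term + ('I_n + (term + unit)))))%type.

Notation GVar x := (inl x).
Notation GClause cl := (inr (inl cl)).
Notation GCoef tm := (inr (inr (inl tm))).
Notation GHole j := (inr (inr (inr (inl j)))).
Notation GTerm tm := (inr (inr (inr (inr (inl tm))))).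
Notation GOut := (inr (inr (inr (inr (inr tt))))).

Lemma big_gate (R : Type) (idx : R) (op : Monoid.com_law idx)
    (P : pred php_gate) (F : php_gate -> R) :
  \big[op/idx]_(g | P g) F g =
    op (\big[op/idx]_(x | P (GVar x)) F (GVar x))
   (op (\big[op/idx]_(cl | P (GClause cl)) F (GClause cl))
   (op (\big[op/idx]_(tm | P (GCoef tm)) F (GCoef tm))
   (op (\big[op/idx]_(j | P (GHole j)) F (GHole j))
   (op (\big[op/idx]_(tm | P (GTerm tm)) F (GTerm tm))
       (\big[op/idx]_(u : unit | P (inr (inr (inr (inr (inr u))))))
          F (inr (inr (inr (inr (inr u)))))))))).
Proof. by rewrite !big_sumType. Qed.

Definition php_wire (g h : php_gate) : bool :=
  match g, h with
  | GVar x, GHole j => x.2 == j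
  | GClause cl, GTerm tm => cl == tm.2
  | GCoef tm, GTerm tm' => tm == tm'
  | GHole j, GTerm tm => j \in tm.1
  | GTerm _, inr (inr (inr (inr (inr _)))) => true
  | _, _ => false
  end.

Definition php_level (g : php_gate) : nat :=
  match g with
  | GVar _ | GClause _ | GCoef _ => 0
  | GHole _ => 1
  | GTerm _ => 2
  | _ => 3
  end.

Definition php_label (g : php_gate) : gate_label rat (ips_var (PHP n)) :=
  match g with
  | GVar x => LVar _ (inl x : ips_var (PHP n))
  | GClause cl => LVar _ (inr (clause_elt cl) : ips_var (PHP n))
  | GCoef tm => LConst _ (term_coef tm)
  | GTerm _ => LMul _ _
  | _ => LAdd _ _
  end.

Lemma php_wire_level g h : php_wire g h -> (php_level g < php_level h)%N.
Proof.
by case: g => [?|[?|[?|[?|[?|?]]]]]; case: h => [?|[?|[?|[?|[?|?]]]]].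
Qed.

Lemma php_label_input g :
  is_input (php_label g) = [forall h, ~~ php_wire h g].
Proof.
case: g => [x|[cl|[tm|[j|[tm|[]]]]]] /=; apply/esym;
  try by apply/forallP=> -[?|[?|[?|[?|[?|?]]]]].
- by apply/forallP => /(_ (GVar (ord0, j))) /=; rewrite eqxx.
- by apply/forallP => /(_ (GCoef tm)) /=; rewrite eqxx.
- by apply/forallP => /(_ (GTerm (set0, inl ord0))).
Qed.

Lemma php_single_output g : [forall h, ~~ php_wire g h] = (g == GOut).
Proof.
case: g => [x|[cl|[tm|[j|[tm|[]]]]]]; last first.
  by rewrite eqxx; apply/forallP=> -[?|[?|[?|[?|[?|?]]]]].
- by apply/forallP => /(_ GOut).
- by apply/forallP => /(_ (GTerm (setT, inl ord0))) /=; rewrite in_setT.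
- by apply/forallP => /(_ (GTerm tm)) /=; rewrite eqxx.
- by apply/forallP => /(_ (GTerm (set0, cl))) /=; rewrite eqxx.
- by apply/forallP => /(_ (GHole x.2)) /=; rewrite eqxx.
Qed.

Definition php_circuit : circuit rat (ips_var (PHP n)) :=
  Circuit (level_acyclic php_wire_level)
    (level_connected php_wire_level php_single_output)
    php_label_input php_single_output.

Definition act_gate (ps : php_group n) (g : php_gate) : php_gate :=
  match g with
  | GVar x => GVar (php_act n x ps)
  | GClause cl => GClause (act_clause ps cl)
  | GCoef tm => GCoef (act_term ps tm)
  | GHole j => GHole (ps.2 j)
  | GTerm tm => GTerm (act_term ps tm)
  | _ => GOut
  end.

Lemma act_gate_inj ps : injective (act_gate ps).
Proof.
move=> [x|[?|[?|[?|[?|[]]]]]] [y|[?|[?|[?|[?|[]]]]]] //= [].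
- by case: x y => [i j] [k l] /= /perm_inj-> /perm_inj->.
- by move/act_clause_inj->.
- by move=> eqA eqc; congr (GCoef _); apply: (@act_term_inj ps); congr pair.
- by move/perm_inj->.
- by move=> eqA eqc; congr (GTerm _); apply: (@act_term_inj ps); congr pair.
Qed.

Lemma php_circuit_symmetric : symmetric_ips (php_act n) php_circuit.
Proof.
move=> ps; exists (perm (@act_gate_inj ps)); split=> [g h|g]; rewrite !permE.
  case: g => [x|[?|[?|[j|[?|[]]]]]]; case: h => [y|[?|[?|[?|[?|[]]]]]] //=.
  - by rewrite (inj_eq perm_inj).
  - by rewrite (inj_eq (@act_clause_inj ps)).
  - by rewrite -/(act_term ps _) (inj_eq (@act_term_inj ps)).
  - by rewrite mem_imset //; exact: perm_inj.
case: g => [x|[cl|[tm|[j|[tm|[]]]]]] //=.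
  by congr (LVar _ _); rewrite -ips_act_clause.
by rewrite act_term_coef.
Qed.

(** * The certificate computed by the circuit *)

(** Stated over the x variables alone, as y-linearity requires of the cofactors. *)
Definition term_cofactor (tm : term) : {mpoly rat[#|php_var n|]} :=
  (term_coef tm)%:MP * \prod_(j in tm.1) \sum_i php_x i j.

Let lift_x := msubst (fun x => mvar rat (inl x : ips_var (PHP n))).
Let y cl := mvar rat (inr (clause_elt cl) : ips_var (PHP n)).

Definition php_certificate : {mpoly rat[#|ips_var (PHP n)|]} :=
  \sum_(tm : term) lift_x (term_cofactor tm) * y tm.2.

Let hole j := \sum_(i < n.+1) mvar rat (inl (i, j) : ips_var (PHP n)).

Lemma lift_term_cofactor tm :
  lift_x (term_cofactor tm) = (term_coef tm)%:MP * \prod_(j in tm.1) hole j.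
Proof.
rewrite /lift_x /term_cofactor rmorphM /= msubstC rmorph_prod /=.
congr (_ * _); apply: eq_bigr => j _; rewrite rmorph_sum /=.
by apply: eq_bigr => i _; rewrite msubst_var.
Qed.

Lemma php_circuit_computes : computes php_circuit php_certificate.
Proof.
exists (fun g : php_gate => match g with
  | GVar x => mvar rat (inl x : ips_var (PHP n))
  | GClause cl => y cl
  | GCoef tm => (term_coef tm)%:MP
  | GHole j => hole j
  | GTerm tm => lift_x (term_cofactor tm) * y tm.2
  | _ => php_certificate
  end); split=> // -[x|[cl|[tm|[j|[tm|[]]]]]] //=.
- rewrite big_gate /= !big_pred0_eq !addr0.
  rewrite (reindex_onto (fun i : 'I_n.+1 => (i, j)) fst) /=.
    by apply: eq_bigl => i; rewrite !eqxx.
  by move=> [i k] /= /eqP->.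
- rewrite big_gate /= !big_pred0_eq !big_pred1_eq mul1r !mulr1.
  by rewrite lift_term_cofactor mulrC mulrA.
- by rewrite big_gate /= !big_pred0_eq !add0r addr0.
Qed.

Lemma php_certificate_ips : ips_certificate php_certificate.
Proof.
split; rewrite /php_certificate rmorph_sum /=.
  by apply: big1 => tm _; rewrite rmorphM /= /y msubst_var mulr0.
apply: etrans _ certificate_identity; apply: eq_bigr => tm _.
rewrite rmorphM [X in _ * X]msubst_var lift_term_cofactor; congr (_ * _).
rewrite rmorphM [X in X * _]msubstC rmorph_prod; congr (_ * _).
apply: eq_bigr => j _; rewrite [LHS]rmorph_sum; apply: eq_bigr => i _.
exact: msubst_var.
Qed.

(** Several clauses may name one axiom, so the cofactors of all terms with the same y variable are
    added up. *)
Lemma php_certificate_y_linear : y_linear php_certificate.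
Proof.
exists (fun f => \sum_(tm : term | clause_elt tm.2 == f) term_cofactor tm).
rewrite /php_certificate (partition_big (fun tm => clause_elt tm.2) predT) //=.
apply: eq_bigr => f _; rewrite rmorph_sum mulr_sumr /=.
by apply: eq_bigr => tm /eqP <-; rewrite mulrC.
Qed.

(** * The size bound *)

Lemma card_PHP : (#|` PHP n| <= #|clause|)%N.
Proof.
have PHP_sub : (PHP n `<=` [fset clause_poly cl | cl in clause])%fset.
  by apply/fsubsetP => f /PHP_clause[cl ->]; apply/imfsetP; exists cl.
apply: leq_trans (fsubset_leq_card PHP_sub) _; rewrite [leqRHS]cardE.
exact: leq_imfset_card.
Qed.

(** The quotient of (k+1)^2 2^k by 3^k peaks at k = 4 with value 400/81 < 5; afterwards 2 (k+2)^2 <=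
    3 (k+1)^2 drives the induction. *)
Lemma sqr_pow2_le_pow3 k : ((k + 1) ^ 2 * 2 ^ k <= 5 * 3 ^ k)%N.
Proof.
case: (ltnP k 5) => [|]; first by case: k => [|[|[|[|[|]]]]].
elim: k => // k IHk; rewrite leq_eqVlt => /predU1P[<- //|lt4k].
by rewrite !expnS !expn0; move: (IHk lt4k); rewrite !expnS !expn0; nia.
Qed.

Lemma card_clause : #|clause| = (n.+1 + n.+1 * n.+1 * n)%N.
Proof. by rewrite card_sum !card_prod !card_ord. Qed.

Lemma card_term : #|term| = (2 ^ n * (n.+1 + n.+1 * n.+1 * n))%N.
Proof.
rewrite card_prod card_clause -(cardsT {set 'I_n}) -powersetT card_powerset.
by rewrite cardsT card_ord.
Qed.

Lemma php_circuit_size :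
  (0 < n)%N -> (ips_size php_circuit <= 45 * 3 ^ n * n)%N.
Proof.
move=> n_gt0; have := card_PHP; rewrite card_clause => le_F.
rewrite /ips_size; move: le_F; move: #|` _| => F le_F.
rewrite [#|gate _|](_ : _ = #|php_gate|) // [#|php_var n|]card_prod.
rewrite !card_sum card_term !card_prod !card_ord card_unit geq_max.
(* The expanded gate count has nine summands, each at most 2^n M <= 5 * 3^n * n, whence the constant
   45. *)
pose M := (n.+1 * n.+1 * n)%N.
have le_nM : (n.+1 <= M)%N by rewrite /M; nia.
have le_nnM : (n.+1 * n <= M)%N by rewrite /M; nia.
have le_ME : (M <= 2 ^ n * M)%N by rewrite leq_pmull ?expn_gt0.
have le_nE : (2 ^ n * n.+1 <= 2 ^ n * M)%N by rewrite leq_mul.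
have le_ET : (2 ^ n * M <= 5 * 3 ^ n * n)%N.
  have := sqr_pow2_le_pow3 n; rewrite -(leq_pmul2r n_gt0); apply: leq_trans.
  by rewrite /M addn1; apply/eq_leq; ring.
rewrite -/M in le_F *; rewrite mulnDr; lia.
Qed.

End PigeonholeCircuit.

Theorem theorem6p7 :
  exists c : nat, forall n : nat, (1 <= n)%N ->
    exists C : circuit rat (ips_var (PHP n)),
      [/\ y_linear_ips_refutation C,
          symmetric_ips (php_act n) C
        & (ips_size C <= c * 3 ^ n * n)%N].
Proof.
exists 45 => n n_gt0; exists (php_circuit n); split.
- exists (php_certificate n); split.
  + exact: php_circuit_computes.
  + exact: php_certificate_ips.
  + exact: php_certificate_y_linear.
- exact: php_circuit_symmetric.
- exact: php_circuit_size.
Qed.
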